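(* Let $n\ge 2$, let $F$ be a field of order greater than $2$, and let $\Sigma_n$ be the $n$-dimensional projective space over $F$. Let $A=\{A_1,\ldots,A_{n+1}\}$ and $B=\{B_1,\ldots,B_{n+1}\}$ be two simplexes in $\Sigma_n$ which do not share a point or a face, with a correspondence $A_i\leftrightarrow B_i$ such that, for all distinct $i,j$, the edge $A_iA_j$ intersects the edge $B_iB_j$ in a point. Let $\alpha_1,\ldots,\alpha_{n+1}$ be the faces of $A$ and let $\beta_k$ be the face of $B$ corresponding to $\alpha_k$. Then: (a) The intersections of corresponding $t$-spaces of $A$ and $B$ are $(t-1)$-dimensional subspaces, for $t=1,2,\ldots,n-1$. (b) For distinct $i,j$, the subspaces $\alpha_i\cap\alpha_j$ and $\beta_i\cap\beta_j$ together generate an $(n-1)$-dimensional space, i.e. a hyperplane of $\Sigma_n$.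
   Context: Dimension means projective dimension (the empty subspace has dimension $-1$). A simplex in $\Sigma_n$ is a set of $n+1$ points that generates $\Sigma_n$. An edge is the line joining two points of a simplex; a face is a hyperplane generated by $n$ of its points. A $t$-space of $A$ is the $t$-dimensional subspace generated by $t+1$ points $A_i$, $i\in I$, $|I|=t+1$; the corresponding $t$-space of $B$ is the one generated by the points $B_i$, $i\in I$. In particular a face of $A$ generated by $\{A_i: i\neq k\}$ corresponds to the face of $B$ generated by $\{B_i:i\ne k\}$. ''The edges intersect in a point'' means that they are distinct lines whose intersection is exactly one point. *)

(* Defs.v *)
From HB Require Import structures.
From mathcomp Require Import all_boot all_order all_algebra.

Set Implicit Arguments.
Unset Strict Implicit.
Unset Printing Implicit Defensive.

Import GRing.Theory.

Local Open Scope ring_scope.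

(* F may be infinite, so "order greater than 2" is "has more than 2 elements". *)
Definition order_gt2 (F : fieldType) : Prop :=
  exists s : seq F, uniq s /\ (2 < size s)%N.

(* A projective subspace of the n-dimensional projective space over F is a
   linear subspace of F^(n+1); join, meet and inclusion are those of vspaces. *)
Notation psubspace F n := {vspace 'rV[F]_n.+1}.

(* Projective dimension; int-valued so that the empty subspace has
   dimension -1. *)
Definition pdim (F : fieldType) (n : nat) (U : psubspace F n) : int :=
  (\dim U)%:Z - 1.

Definition is_point (F : fieldType) (n : nat) (P : psubspace F n) : Prop :=
  pdim P = 0.

(* The index set carries the correspondence A_i <-> B_i between simplexes. *)
Definition simplex (F : fieldType) (n : nat) (A : 'I_n.+1 -> psubspace F n)
    : Prop :=
  [/\ forall i, is_point (A i), injective A & (\sum_i A i = fullv)%VS].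

Definition gen_space (F : fieldType) (n : nat) (A : 'I_n.+1 -> psubspace F n)
    (I : {set 'I_n.+1}) : psubspace F n :=
  (\sum_(i in I) A i)%VS.

Definition edge (F : fieldType) (n : nat) (A : 'I_n.+1 -> psubspace F n)
    (i j : 'I_n.+1) : psubspace F n :=
  gen_space A [set i; j].

Definition face (F : fieldType) (n : nat) (A : 'I_n.+1 -> psubspace F n)
    (k : 'I_n.+1) : psubspace F n :=
  gen_space A [set~ k].

Definition meet_in_point (F : fieldType) (n : nat) (L M : psubspace F n)
    : Prop :=
  L <> M /\ is_point (L :&: M)%VS.

(* Main.v *)
(* For a nonempty set I of vertices, write A_I and B_I for the corresponding
   subspaces. Modulo W = A_I meet B_I, any two of the points A_i, i in I, are
   linearly dependent, because the edges A_iA_j and B_iB_j share a point; so W has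
   codimension at most 1 in A_I. Codimension 0 would mean A_I = B_I. As A_i and
   B_i are distinct, for l outside I the common point of A_iA_l and B_iB_l would
   then force A_{I+l} = B_{I+l}, and adding vertices one at a time would yield a
   common face. Hence the codimension is exactly 1, which gives (a); (b) follows
   by taking for I the complement of {i, j}. *)
Require Import Defs.
From HB Require Import structures.
From mathcomp Require Import all_boot all_order all_algebra.
From mathcomp Require Import zify.

Set Implicit Arguments.
Unset Strict Implicit.
Unset Printing Implicit Defensive.

Import GRing.Theory.

Local Open Scope ring_scope.

Section Points.

Variables (F : fieldType) (n : nat).
Implicit Types U V W P : psubspace F n.

Lemma is_pointP P : is_point P <-> \dim P = 1%N.
Proof.
by rewrite /is_point /pdim; split=> [/eqP|->//]; rewrite subr_eq0 => /eqP[].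
Qed.

Lemma point_sub P U v : is_point P -> v \in P -> v != 0 -> v \in U ->
  (P <= U)%VS.
Proof.
move=> /is_pointP dP vP nz vU.
have /eqP <- : <[v]>%VS == P by rewrite eqEdim dim_vline nz dP -memvE vP.
by rewrite -memvE.
Qed.

Lemma point_eq P Q v : is_point P -> is_point Q -> v \in P -> v \in Q ->
  v != 0 -> P = Q.
Proof.
move=> hP hQ vP vQ nz; apply: subv_anti.
by rewrite (point_sub hP vP nz vQ) (point_sub hQ vQ nz vP).
Qed.

End Points.

Section Simplex.

Variables (F : fieldType) (n : nat) (A : 'I_n.+1 -> psubspace F n).
Implicit Types I J : {set 'I_n.+1}.

Lemma gen_space_mono I J : I \subset J -> (gen_space A I <= gen_space A J)%VS.
Proof.
by move=> /subsetP sIJ; apply/subv_sumP => i /sIJ iJ; apply: (sumv_sup i).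
Qed.

Lemma gen_spaceU I J :
  gen_space A (I :|: J) = (gen_space A I + gen_space A J)%VS.
Proof.
apply: subv_anti; rewrite subv_add !gen_space_mono ?subsetUl ?subsetUr // !andbT.
apply/subv_sumP => i; rewrite inE => /orP[iI|iJ].
  by apply: subv_trans (addvSl _ _); apply: (sumv_sup i).
by apply: subv_trans (addvSr _ _); apply: (sumv_sup i).
Qed.

Lemma gen_space1 i : gen_space A [set i] = A i.
Proof. by rewrite /gen_space big_set1. Qed.

Lemma edgeE i j : edge A i j = (A i + A j)%VS.
Proof. by rewrite /edge gen_spaceU !gen_space1. Qed.

Hypothesis hA : simplex A.

Lemma dim_gen_space_le I : (\dim (gen_space A I) <= #|I|)%N.
Proof.
apply: leq_trans (dimv_leq_sum _ _ _) _; rewrite -sum1_card leq_sum // => i _.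
by case: hA => /(_ i)/is_pointP->.
Qed.

(** The spans of [I] and of its complement have vector dimensions at most their cardinalities and
    together fill a space of dimension [n.+1], so both bounds are attained. *)
Lemma dim_gen_space I : \dim (gen_space A I) = #|I|.
Proof.
have full : (gen_space A I + gen_space A (~: I) = fullv)%VS.
  case: hA => _ _ <-; rewrite -gen_spaceU setUCr.
  by apply: eq_bigl => i; rewrite inE.
apply/eqP; rewrite eqn_leq dim_gen_space_le /=.
have := (dimv_add_leqif (gen_space A I) (gen_space A (~: I))).1.
rewrite full dimvf /dim /= mul1n => h.
rewrite -(leq_add2r #|~: I|) cardsC card_ord (leq_trans h) //.
by rewrite leq_add2l dim_gen_space_le.
Qed.

(** One inclusion is monotonicity; equality follows by comparing the dimension formula for sum and
    intersection with its counterpart for cardinalities. *)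
Lemma gen_spaceI I J :
  (gen_space A I :&: gen_space A J)%VS = gen_space A (I :&: J).
Proof.
apply/esym/eqP; rewrite eqEdim subv_cap !gen_space_mono ?subsetIl ?subsetIr //=.
rewrite -(leq_add2l (\dim (gen_space A I + gen_space A J))) dimv_sum_cap.
by rewrite -gen_spaceU !dim_gen_space cardsUI.
Qed.

Lemma face_capE i j :
  (face A i :&: face A j)%VS = gen_space A (~: [set i; j]).
Proof. by rewrite /face gen_spaceI setCU. Qed.

End Simplex.

Section MeetingEdges.

Variables (F : fieldType) (n : nat) (A B : 'I_n.+1 -> psubspace F n).
Hypotheses (hA : simplex A) (hB : simplex B).
Hypothesis hedge :
  forall i j, i <> j -> is_point (edge A i j :&: edge B i j)%VS.
Implicit Type I : {set 'I_n.+1}.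

Lemma edge_meet_vector i j : i != j ->
  exists p, [/\ p != 0, p \in edge A i j & p \in edge B i j].
Proof.
move=> /eqP/hedge/is_pointP d1.
have nz : (edge A i j :&: edge B i j)%VS != 0%VS by rewrite -dimv_eq0 d1.
exists (vpick (edge A i j :&: edge B i j)%VS); rewrite vpick0.
by have := memv_pick (edge A i j :&: edge B i j)%VS; rewrite memv_cap => /andP[].
Qed.

Lemma dim_gen_space_cap_ge I :
  (#|I| <= (\dim (gen_space A I :&: gen_space B I)).+1)%N.
Proof.
set W := (_ :&: _)%VS; have [hAp _ _] := hA.
have [sub|] := boolP [forall i in I, (A i <= W)%VS].
  rewrite -(dim_gen_space hA) leqW // dimvS //; apply/subv_sumP => i iI.
  by move/forall_inP: sub; apply.
rewrite negb_forall_in => /exists_inP[i iI niW].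
(* A vertex [A i] outside [W] serves as pivot: adding this one point to [W] recovers the whole
   span. *)
suff sub : (gen_space A I <= W + A i)%VS.
  rewrite -(dim_gen_space hA) (leq_trans (dimvS sub)) //.
  rewrite (leq_trans (dimv_add_leqif _ _).1) //.
  by have /is_pointP-> := hAp i; rewrite addn1.
apply/subv_sumP => j jI; have [->|nji] := eqVneq j i; first exact: addvSr.
have ij : i != j by rewrite eq_sym.
have [p [nzp pA pB]] := edge_meet_vector ij.
have sub_ij : [set i; j] \subset I by rewrite subUset !sub1set iI.
have pW : p \in W.
  rewrite memv_cap (subvP (gen_space_mono _ sub_ij) _ pA).
  exact: (subvP (gen_space_mono _ sub_ij) _ pB).
move: pA; rewrite edgeE => /memv_addP[u uA [v vA pE]].
(* Otherwise [p] is a nonzero vector of [A i] lying in [W], which puts [A i] inside [W]. *)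
have nzv : v != 0.
  apply: contraNneq niW => v0; rewrite v0 addr0 in pE.
  by apply: (point_sub (hAp i) uA); rewrite -?pE.
apply: (point_sub (hAp j) vA nzv).
by rewrite -[v](addrK u) addrC [v + u]addrC -pE addrC memv_add // rpredN.
Qed.

Hypothesis hpoint : forall i, A i <> B i.

(** Writing the common point of the two edges as [u + v = u' + v'] gives [v = (u' - u) + v'], where
    [u' - u] lies in the common span. If [v] is nonzero it spans [A l], so one enlarged span
    contains the other, and their dimensions agree. *)
Lemma gen_space_eq_setU1 I i l : i \in I -> l \notin I ->
  gen_space A I = gen_space B I ->
  gen_space A (l |: I) = gen_space B (l |: I).
Proof.
move=> iI lI eqI; have [hAp _ _] := hA; have [hBp _ _] := hB.
have il : i != l by apply: contraNneq lI => <-.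
have [p [nzp]] := edge_meet_vector il.
rewrite !edgeE => /memv_addP[u uA [v vA pE]] /memv_addP[u' uB [v' vB pE']].
have sA : (A i <= gen_space B I)%VS by rewrite -eqI; apply: (sumv_sup i).
have sB : (B i <= gen_space B I)%VS by apply: (sumv_sup i).
have duu : u' - u \in gen_space B I.
  by rewrite rpredB ?(subvP sA u) ?(subvP sB u').
have vE : v = (u' - u) + v' by rewrite addrAC -pE' pE addrC addKr.
have nzv : v != 0.
  apply/eqP => v0; apply: (@hpoint i).
  (* With [v = 0], [v'] lies in the spans of two disjoint sets of vertices of [B]. Once it vanishes,
     [p] is common to [A i] and [B i]. *)
  have v'0 : v' = 0.
    have : v' \in (gen_space B I :&: gen_space B [set l])%VS.
      rewrite memv_cap gen_space1 vB andbT.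
      have -> : v' = - (u' - u) by apply/eqP; rewrite -addr_eq0 addrC -vE v0.
      by rewrite rpredN.
    rewrite (gen_spaceI hB); suff -> : I :&: [set l] = set0.
      by rewrite /gen_space big_set0 memv0 => /eqP.
    by apply/eqP; rewrite setI_eq0 disjoint_sym disjoints1.
  apply: (@point_eq _ _ _ _ p) => //; first by rewrite pE v0 addr0.
  by rewrite pE' v'0 addr0.
apply/eqP; rewrite eqEdim !dim_gen_space // leqnn andbT !gen_spaceU !gen_space1.
rewrite subv_add eqI addvSr andbT; apply: (point_sub (hAp l) vA nzv).
by rewrite vE addrC memv_add.
Qed.

Hypothesis hface : forall i, face A i <> face B i.

Lemma gen_space_neq I : (0 < #|I| <= n)%N -> gen_space A I <> gen_space B I.
(* Induction on the number of vertices short of a face; [I] being nonempty supplies the [i] needed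
   to add [l]. *)
Proof.
have [m] := ubnP (n - #|I|); elim: m I => // m IH I ltm /andP[I0 In] eqI.
have /card_gt0P[l] : (0 < #|~: I|)%N.
  by rewrite -(ltn_add2l #|I|) cardsC card_ord addn0 ltnS.
rewrite inE => lI; have /card_gt0P[i iI] := I0.
have [In'|nI] := ltnP #|I| n.
  apply: (IH (l |: I)); last exact: gen_space_eq_setU1 iI lI eqI.
    by rewrite cardsU1 lI add1n; rewrite -ltnS (leq_trans _ ltm) // ltnS ltn_sub2l.
  by rewrite cardsU1 lI add1n.
apply: (@hface l); rewrite /face; suff <- : I = [set~ l] by [].
apply/eqP; rewrite eqEcard cardsC1 card_ord /= nI andbT.
by apply/subsetP => k kI; rewrite !inE; apply: contraNneq lI => <-.
Qed.

Lemma dim_gen_space_cap I : (0 < #|I| <= n)%N ->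
  (\dim (gen_space A I :&: gen_space B I)).+1 = #|I|.
Proof.
move=> hI; apply/eqP; rewrite eqn_leq dim_gen_space_cap_ge andbT ltnNge.
apply/negP => le; apply: (gen_space_neq hI).
have /eqP capA : (gen_space A I :&: gen_space B I)%VS == gen_space A I.
  by rewrite eqEdim capvSl (dim_gen_space hA).
have /eqP capB : (gen_space A I :&: gen_space B I)%VS == gen_space B I.
  by rewrite eqEdim capvSr (dim_gen_space hB).
by rewrite -{1}capA capB.
Qed.

End MeetingEdges.

Theorem theorem3p3 (n : nat) (F : fieldType) (A B : 'I_n.+1 -> psubspace F n)
    (hn : (2 <= n)%N) (hF : order_gt2 F)
    (hA : simplex A) (hB : simplex B)
    (hpoint : forall i j, A i <> B j)
    (hface : forall i j, face A i <> face B j)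
    (hedge : forall i j, i <> j -> meet_in_point (edge A i j) (edge B i j)) :
  (forall t : nat, (1 <= t <= n - 1)%N ->
    forall I : {set 'I_n.+1}, #|I| = t.+1 ->
      pdim (gen_space A I :&: gen_space B I)%VS = t%:Z - 1)
  /\
  (forall i j : 'I_n.+1, i <> j ->
    pdim ((face A i :&: face A j) + (face B i :&: face B j))%VS = n%:Z - 1).
Proof.
have hpt i j : i <> j -> is_point (edge A i j :&: edge B i j)%VS.
  by case/hedge.
have dimI I := dim_gen_space_cap hA hB hpt (fun i => @hpoint i i)
  (fun i => @hface i i) (I := I).
split=> [t /andP[t1 tn] I cI | i j /eqP ij].
  have : (0 < #|I| <= n)%N by rewrite cI; lia.
  by move/dimI; rewrite cI /pdim => -[->].
(* The two spans have vector dimension [n - 1] and meet in dimension [n - 2], so their sum has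
   dimension [2(n - 1) - (n - 2) = n]. The bound [2 <= n] makes this vertex set nonempty. *)
have cI : #|~: [set i; j]| = (n - 1)%N by rewrite cardsCs setCK card_ord cards2 ij; lia.
have dI : (0 < #|~: [set i; j]| <= n)%N by rewrite cI; lia.
rewrite (face_capE hA) (face_capE hB) /pdim.
have := dimv_sum_cap (gen_space A (~: [set i; j])) (gen_space B (~: [set i; j])).
have := dimI _ dI; rewrite !dim_gen_space // cI; lia.
Qed.
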